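(* Let $n\ge2$ be an integer, $\delta\in(0,1)$, $a\in\mathbb{S}^{D-1}$ and $\mathcal{A}=\operatorname{Span}\{a^{\otimes n}\}$. Then there exists a linear subspace $\hat{\mathcal{A}}\subseteq\operatorname{Sym}((\mathbb{R}^D)^{\otimes n})$ with $\dim(\hat{\mathcal{A}})=1$ and $\|P_{\mathcal{A}}-P_{\hat{\mathcal{A}}}\|_{F\to F}=\delta$ such that the program $\max_{x\in\mathbb{S}^{D-1}}F_{\hat{\mathcal{A}}}(x)$ possesses a strict local maximizer of objective value exactly $\delta^2$.
   Context: $\mathbb{S}^{D-1}$ is the unit sphere of $\mathbb{R}^D$. $(\mathbb{R}^D)^{\otimes n}$ carries the Frobenius inner product and norm $\|\cdot\|_F$; $\operatorname{Sym}$ denotes the subspace of symmetric tensors. For a subspace $\mathcal{B}$, $P_{\mathcal{B}}$ is the orthogonal projector onto $\mathcal{B}$ and $F_{\mathcal{B}}(x):=\|P_{\mathcal{B}}(x^{\otimes n})\|_F^2$. $\|\cdot\|_{F\to F}$ is the operator norm induced by the Frobenius norm.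
   Formalization: The formal theorem assumes D ≥ 2: for D = 1 the tensor space is one-dimensional, so the subspace must equal A and the projector distance is 0, not δ, and the claim as stated is false. *)

(* Defs.v *)
From HB Require Import structures.
From mathcomp Require Import all_boot all_order all_fingroup all_algebra.
From mathcomp Require Import boolp classical_sets reals topology normedtype.

Set Implicit Arguments.
Unset Strict Implicit.
Unset Printing Implicit Defensive.

Import Order.TTheory GRing.Theory Num.Theory.
Import numFieldNormedType.Exports.

Local Open Scope ring_scope.
Local Open Scope classical_set_scope.

(* The library norm on 'rV[R]_D is the sup norm, hence the explicit sum of
   squares. The topology it induces is the usual one. *)
Definition unit_sphere (R : realType) (D : nat) : set 'rV[R]_D :=
  [set x | \sum_(i < D) x 0 i ^+ 2 = 1].
Arguments unit_sphere : clear implicits.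

(* (R^D)^{⊗n}, as arrays indexed by the multi-indices i : 'I_n -> 'I_D. The
   scalars are R^o so that the library's vectType structure is found. *)
Notation tensor R D n := {ffun {ffun 'I_n -> 'I_D} -> R^o}.

Definition tpow (R : realType) (D n : nat) (x : 'rV[R]_D) : tensor R D n :=
  [ffun i : {ffun 'I_n -> 'I_D} => \prod_(k < n) x 0 (i k) : R^o].

Section Frobenius.
Variables (R : realType) (D n : nat).
Implicit Types (S T : tensor R D n) (B : {vspace tensor R D n}).

Definition frob S T : R := \sum_i (S i : R) * (T i : R).

Lemma frob_bilinear : bilinear_for
  (GRing.Scale.Law.clone _ _ *%R _)
  (GRing.Scale.Law.clone _ _ (@idfun R \; *%R) _) frob.
Proof.
split=> [U|U] c S T /=; rewrite /frob mulr_sumr -big_split; apply: eq_bigr => i _.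
  by rewrite !ffunE mulrDl -mulrA.
by rewrite !ffunE mulrDr /= mulrCA.
Qed.

HB.instance Definition _ := bilinear_isBilinear.Build R _ _ _
  (GRing.Scale.Law.clone _ _ *%R _)
  (GRing.Scale.Law.clone _ _ (@idfun R \; *%R) _) frob frob_bilinear.

Lemma frob_sym S T : frob S T = (-1) ^+ false * idfun (frob T S).
Proof. by rewrite mul1r; apply: eq_bigr => i _; rewrite mulrC. Qed.

HB.instance Definition _ :=
  isHermitianSesquilinear.Build R _ false idfun frob frob_sym.

Lemma frob_gt0 T : T != 0 -> 0 < frob T T.
Proof.
move=> T0; rewrite lt_neqAle eq_sym sumr_ge0 ?andbT; last first.
  by move=> i _; rewrite -expr2 sqr_ge0.
apply: contra_neq T0 => /psumr_eq0P T0; apply/ffunP => i; rewrite ffunE.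
by apply/eqP; rewrite -sqrf_eq0 expr2 T0// => j _; rewrite -expr2 sqr_ge0.
Qed.

HB.instance Definition _ := isDotProduct.Build R _ frob frob_gt0.

Definition frob_norm T : R := Num.sqrt (frob T T).

Definition tperm_axes (s : 'S_n) T : tensor R D n :=
  [ffun i : {ffun 'I_n -> 'I_D} => T [ffun k => i (s k)]].

Lemma tperm_axes_linear s : linear (tperm_axes s).
Proof. by move=> c S T; apply/ffunP => i; rewrite !ffunE. Qed.

HB.instance Definition _ s := GRing.isLinear.Build R _ _ _ (tperm_axes s)
  (tperm_axes_linear s).

Definition symtensor : {vspace tensor R D n} :=
  (\bigcap_(s : 'S_n) fixedSpace (linfun (tperm_axes s)))%VS.

Lemma symtensorP T : reflect
  (forall (s : 'S_n) (i : {ffun 'I_n -> 'I_D}), T [ffun k => i (s k)] = T i)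
  (T \in symtensor).
Proof.
apply: (iffP idP) => [|Tsym].
  rewrite memvE => /subv_bigcapP Tsym s i; have := Tsym s isT.
  by rewrite -memvE => /fixedSpaceP; rewrite lfunE => /ffunP/(_ i); rewrite ffunE.
rewrite memvE; apply/subv_bigcapP => s _; rewrite -memvE.
by apply/fixedSpaceP; rewrite lfunE; apply/ffunP => i; rewrite ffunE.
Qed.

Definition orthproj B : 'End(tensor R D n) := daddv_pi B (orthov frob B).

Let capv_orthov B : (B :&: orthov frob B = 0)%VS.
Proof.
apply/eqP; rewrite -subv0; apply/subvP => T; rewrite memv_cap memv0.
case/andP=> TB /mem_orthovP/(_ T TB) T0.
by apply: contraTT isT => /frob_gt0; rewrite T0 ltxx.
Qed.

Let addv_orthov B : (B + orthov frob B = fullv)%VS.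
Proof.
pose g T : {ffun 'I_(\dim B) -> R^o} := [ffun k : 'I_(\dim B) =>
    frob T (vbasis B)`_k : R^o].
have g_lin : linear g.
  move=> c S T; apply/ffunP => k; rewrite !ffunE.
  exact: (frob_bilinear.1 _ c S T).
pose gL := GRing.isLinear.Build R _ _ _ g g_lin.
pose G : {linear _ -> _} := HB.pack g gL.
have kerG : (lker (linfun G) <= orthov frob B)%VS.
  apply/subvP => T; rewrite memv_ker lfunE /= => /eqP/ffunP gT0.
  apply/mem_orthovP => S /coord_vbasis ->; rewrite linear_sumr big1// => k _.
  by rewrite linearZr_LR /=; have := gT0 k; rewrite !ffunE => ->; rewrite mulr0.
apply/eqP; rewrite eqEdim subvf /= dimv_disjoint_sum ?capv_orthov//.
rewrite -(limg_ker_dim (linfun G) fullv) capfv addnC leq_add ?dimvS//.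
apply: leq_trans (dimvS (subvf _)) _.
by rewrite dimvf /dim /= card_ord muln1.
Qed.

Lemma orthprojP B T : orthproj B T \in B /\
  {in B, forall S, frob (T - orthproj B T) S = 0}.
Proof.
split=> [|S SB]; first exact: memv_pi.
have TBB : T \in (B + orthov frob B)%VS by rewrite addv_orthov memvf.
have TE := daddv_pi_add (capv_orthov B) TBB.
rewrite -[X in X - _]TE addrC addKr.
exact: (mem_orthovP (memv_pi _ _ _)).
Qed.

Definition opnorm (f : 'End(tensor R D n)) : R :=
  sup [set frob_norm (f T) | T in [set T | frob_norm T <= 1]].

Lemma opnorm_has_sup (f : 'End(tensor R D n)) :
  has_sup [set frob_norm (f T) | T in [set T | frob_norm T <= 1]].
Proof.
split.
  exists (frob_norm (f 0)); exists 0 => //=.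
  by rewrite /frob_norm linear0r sqrtr0 ler01.
pose e i : tensor R D n := [ffun j => (i == j)%:R : R^o].
pose c j : R := \sum_i `|f (e i) j : R|.
exists (Num.sqrt (\sum_j c j ^+ 2)) => _ [T /= T1 <-].
have {}T1 : frob T T <= 1.
  by move: T1; rewrite /frob_norm -[X in _ <= X]sqrtr1 ler_sqrt.
have Ti1 i : `|T i : R| <= 1.
  rewrite -[`|_|]ger0_norm// -sqrtr_sqr -[X in _ <= X]sqrtr1 ler_sqrt//.
  apply: le_trans T1; rewrite real_normK ?num_real// /frob (bigD1 i)//= expr2.
  by rewrite lerDl sumr_ge0// => k _; rewrite -expr2 sqr_ge0.
have TE : T = \sum_i T i *: e i.
  apply/ffunP => j; rewrite sum_ffunE (bigD1 j)//= !ffunE eqxx big1 => [|i ij].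
    by rewrite addr0 /GRing.scale /= mulr1.
  by rewrite !ffunE (negPf ij) /GRing.scale /= mulr0.
have fTj j : `|f T j : R| <= c j.
  rewrite TE linear_sum sum_ffunE; apply: le_trans (ler_norm_sum _ _ _) _.
  apply: ler_sum => i _; rewrite linearZ ffunE /GRing.scale /= normrM.
  by rewrite ler_piMl.
rewrite /frob_norm ler_wsqrtr// ler_sum// => j _.
rewrite -expr2 -real_normK ?num_real// lerXn2r// nnegrE//.
exact: le_trans (fTj j).
Qed.

Definition objective B (x : 'rV[R]_D) : R :=
  frob_norm (orthproj B (tpow n x)) ^+ 2.

End Frobenius.
Arguments symtensor : clear implicits.

Definition strict_local_maximizer (R : realType) (X : topologicalType)
    (C : set X) (F : X -> R) (x : X) : Prop :=
  C x /\ \forall y \near x^', C y -> F y < F x.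

(* Main.v *)
(** Complete [a] by a unit vector [b] orthogonal to it. With
    [c := sqrt (1 - delta^2)], the line spanned by the unit tensor
    [v := delta *: b^n - c *: a^n] makes with [a^n] an angle of sine [delta],
    and the objective at [y] is the square of
    [delta <y,b>^n - c <y,a>^n], which equals [delta] at [y = b]. Near [b] on
    the sphere, [<y,b>^n <= <y,b>^2 <= 1 - <y,a>^2], and the possible gain
    [- c <y,a>^n] is dominated by [delta <y,a>^2]: it is cubic in [<y,a>] for
    [n >= 3], and nonpositive for [n = 2] thanks to the minus sign. *)

Require Import Defs.
From mathcomp Require Import all_boot all_order all_fingroup all_algebra.
From mathcomp Require Import boolp classical_sets reals topology normedtype.
From mathcomp Require Import ring lra.
Import Order.TTheory GRing.Theory Num.Theory.
Import numFieldNormedType.Exports.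
Local Open Scope ring_scope.

(** The gap is the sum of squares of the residual left after removing from [t] its components along
    [u] and [w]. The index type is arbitrary so that this applies both to vectors and to tensors
    indexed by multi-indices. *)
Lemma bessel2 (R : realType) (I : finType) (u w t : I -> R) :
    \sum_i u i ^+ 2 = 1 -> \sum_i w i ^+ 2 = 1 -> \sum_i u i * w i = 0 ->
  (\sum_i t i * u i) ^+ 2 + (\sum_i t i * w i) ^+ 2 <= \sum_i t i ^+ 2.
Proof.
move=> u1 w1 uw0.
have sqE (p q : R) : \sum_i (t i - p * u i - q * w i) ^+ 2 =
    \sum_i t i ^+ 2 + p ^+ 2 * \sum_i u i ^+ 2 + q ^+ 2 * \sum_i w i ^+ 2 +
    - 2 * p * (\sum_i t i * u i) + - 2 * q * (\sum_i t i * w i) +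
    2 * p * q * \sum_i u i * w i.
  by rewrite !mulr_sumr -!big_split; apply: eq_bigr => i _ /=; ring.
have := sqE (\sum_i t i * u i) (\sum_i t i * w i).
rewrite u1 w1 uw0 -subr_ge0 => sqE0.
rewrite (_ : _ - _ = \sum_i (t i - (\sum_j t j * u j) * u i -
    (\sum_j t j * w j) * w i) ^+ 2); last by rewrite sqE0; ring.
by apply: sumr_ge0 => i _; exact: sqr_ge0.
Qed.

(** The column [a^T] has rank at most 1, so its kernel has rank at least [D - 1 > 0]; a nonzero row
    of the kernel is then normalised. *)
Lemma orthonormal_complement (R : realType) (D : nat) (a : 'rV[R]_D) :
  (2 <= D)%N -> exists2 b, unit_sphere R D b & \sum_i a 0 i * b 0 i = 0.
Proof.
move=> D2; pose b := nz_row (kermx a^T).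
have b0 : b != 0.
  rewrite nz_row_eq0 -mxrank_eq0 mxrank_ker -lt0n subn_gt0.
  exact: leq_ltn_trans (rank_leq_col _) D2.
have /sub_kermxP ba : (b <= kermx a^T)%MS by exact: nz_row_sub.
have s0 : 0 < \sum_i b 0 i ^+ 2.
  rewrite lt_neqAle eq_sym sumr_ge0 ?andbT; last by move=> i _; exact: sqr_ge0.
  apply: contra_neq b0 => /psumr_eq0P b0; apply/rowP => i; rewrite mxE.
  by apply/eqP; rewrite -sqrf_eq0 b0// => j _; exact: sqr_ge0.
exists ((Num.sqrt (\sum_i b 0 i ^+ 2))^-1 *: b).
  rewrite /unit_sphere /=.
  under eq_bigr do rewrite mxE exprMn.
  by rewrite -mulr_sumr exprVn sqr_sqrtr ?ltW// mulVf// gt_eqF.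
under eq_bigr do rewrite mxE mulrCA.
rewrite -mulr_sumr; move/matrixP: ba => /(_ 0 0); rewrite !mxE => ba.
suff -> : \sum_i a 0 i * b 0 i = 0 by rewrite mulr0.
by apply: etrans ba; apply: eq_bigr => i _; rewrite mxE mulrC.
Qed.

(** On the sphere, |y - b|^2 = 2 - 2<y,b>, so <y,b> >= 1 forces [y = b]. *)
Lemma dot_lt1 (R : realType) (D : nat) (b y : 'rV[R]_D) :
  unit_sphere R D b -> unit_sphere R D y -> y != b ->
  \sum_i y 0 i * b 0 i < 1.
Proof.
rewrite /unit_sphere /= => b1 y1 yb; rewrite ltNge; apply: contra_neqN yb => le1.
have sq0 : \sum_i (y 0 i - b 0 i) ^+ 2 <= 0.
  rewrite (_ : \sum_i _ = \sum_i y 0 i ^+ 2 + \sum_i b 0 i ^+ 2 +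
    - 2 * \sum_i y 0 i * b 0 i); first by rewrite y1 b1; lra.
  by rewrite mulr_sumr -!big_split; apply: eq_bigr => i _ /=; ring.
have /psumr_eq0P yb0 : \sum_i (y 0 i - b 0 i) ^+ 2 = 0.
  by apply/eqP; rewrite eq_le sq0 sumr_ge0// => i _; exact: sqr_ge0.
apply/rowP => i; apply/eqP; rewrite -subr_eq0 -sqrf_eq0 yb0// => j _.
exact: sqr_ge0.
Qed.

(** Distributing the [n]-fold product of sums produces exactly one term per multi-index. *)
Lemma frob_tpow (R : realType) (D n : nat) (x y : 'rV[R]_D) :
  frob (tpow n x) (tpow n y) = (\sum_i x 0 i * y 0 i) ^+ n.
Proof.
rewrite -[X in _ ^+ X]card_ord -prodr_const bigA_distr_bigA /=.
by apply: eq_bigr => f _; rewrite !ffunE -big_split.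
Qed.

Lemma tpow_sym (R : realType) (D n : nat) (x : 'rV[R]_D) :
  tpow n x \in symtensor R D n.
Proof.
apply/symtensorP => s i; rewrite !ffunE [RHS](reindex_inj (@perm_inj _ s)) /=.
by apply: eq_bigr => k _; rewrite ffunE.
Qed.

Lemma orthproj_line (R : realType) (D n : nat) (v T : tensor R D n) :
  frob v v = 1 -> orthproj <[v]>%VS T = frob T v *: v.
Proof.
move=> v1; have [/vlineP[k ->] /(_ _ (memv_line v))] := orthprojP <[v]>%VS T.
by rewrite linearBl /= linearZl_LR /= v1 mulr1 => /eqP; rewrite subr_eq0 => /eqP ->.
Qed.

Lemma objective_line (R : realType) (D n : nat) (v : tensor R D n)
    (x : 'rV[R]_D) :
  frob v v = 1 -> objective <[v]>%VS x = frob (tpow n x) v ^+ 2.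
Proof.
move=> v1; rewrite /objective orthproj_line// /frob_norm.
rewrite linearZl_LR linearZr_LR /= v1 mulr1 sqr_sqrtr// -expr2.
exact: sqr_ge0.
Qed.

(** In the orthonormal basis [u], [w] the difference of projectors is [d] times the reflection
    matrix [[d, c], [c, -d]], and it vanishes on the orthogonal complement of that plane. It thus
    scales the planar component of every tensor by [d]. *)
Lemma opnorm_line_sub (R : realType) (D n : nat) (u w : tensor R D n)
    (c d : R) :
    frob u u = 1 -> frob w w = 1 -> frob u w = 0 -> 0 < d ->
    c ^+ 2 + d ^+ 2 = 1 ->
  opnorm (orthproj <[u]>%VS - orthproj <[d *: w - c *: u]>%VS) = d.
Proof.
move=> u1 w1 uw d0 cd; set v := d *: w - c *: u.
have frobC (S T : tensor R D n) : frob S T = frob T S.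
  by apply: eq_bigr => i _; rewrite mulrC.
have v_r T : frob T v = d * frob T w - c * frob T u.
  by rewrite linearBr /= !linearZr_LR.
have v1 : frob v v = 1.
  by rewrite v_r (frobC v w) (frobC v u) !v_r (frobC w u) uw u1 w1; lra.
have normE T : frob_norm ((orthproj <[u]>%VS - orthproj <[v]>%VS) T) =
    d * Num.sqrt (frob T u ^+ 2 + frob T w ^+ 2).
  rewrite !lfun_simp !orthproj_line// /frob_norm.
  rewrite linearBl !linearBr /= !linearZl_LR !linearZr_LR /= u1 v1 (frobC v u).
  rewrite !v_r u1 uw -[in RHS](gtr0_norm d0) -sqrtr_sqr -sqrtrM ?sqr_ge0//.
  congr Num.sqrt; set p := frob T u; set t := frob T w.
  have : (c ^+ 2 + d ^+ 2) * p ^+ 2 = p ^+ 2 by rewrite cd mul1r.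
  lra.
apply/eqP; rewrite eq_le; apply/andP; split.
  apply: ge_sup => [|_ [T /= T1 <-]]; first by have [] := opnorm_has_sup
    (orthproj <[u]>%VS - orthproj <[v]>%VS).
  rewrite normE ler_piMr ?(ltW d0)// (le_trans _ T1)// ler_wsqrtr//.
  have sqrE (S : tensor R D n) : \sum_i (S i : R) ^+ 2 = frob S S.
    by apply: eq_bigr => i _; rewrite expr2.
  by rewrite -sqrE; apply: bessel2; rewrite // sqrE.
(* The supremum is attained at [u], a unit vector of the plane. *)
apply: ub_le_sup; first by have [] := opnorm_has_sup
    (orthproj <[u]>%VS - orthproj <[v]>%VS).
exists u; first by rewrite /= /frob_norm u1 sqrtr1.
by rewrite normE u1 uw expr1n expr0n addr0 sqrtr1 mulr1.
Qed.

(** Here [al] and [be] stand for <y,a> and <y,b>. The form is shown to lie strictly between [-d] and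
    [d], and the difference of squares is then factored. *)
Lemma binary_form_bound (R : realType) (n : nat) (c d al be : R) :
    (2 <= n)%N -> 0 <= c <= 1 -> 0 < d < 1 -> `|al| < d -> 0 < be < 1 ->
    al ^+ 2 + be ^+ 2 <= 1 ->
  (d * be ^+ n - c * al ^+ n) ^+ 2 < d ^+ 2.
Proof.
case: n => [|[|n]]// _ /andP[c0 c1] /andP[d0 d1] ald /andP[be0 be1] ab1.
have ben : 0 < be ^+ n.+2 <= be ^+ 2.
  by rewrite exprn_gt0//= -[n.+2]addn2 exprD ler_piMl ?sqr_ge0 ?exprn_ile1// ltW.
have be2 : be ^+ 2 < 1 by rewrite expr_lt1// ltW.
have al1 : `|al| ^+ n <= 1 by rewrite exprn_ile1// ltW// (lt_trans ald).
have aln : `|c * al ^+ n.+2| <= al ^+ 2.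
  rewrite normrM normrX -[n.+2]addn2 exprD real_normK ?num_real//.
  rewrite ger0_norm// mulrA ler_piMl ?sqr_ge0// mulr_ile1//.
  exact: exprn_ge0.
have al2 : al ^+ 2 < d.
  rewrite -real_normK ?num_real// expr2.
  by have := normr_ge0 al; nra.
have lo : al != 0 -> - (c * al ^+ n.+2) < d * al ^+ 2.
  move=> al0; have al2_gt0 : 0 < al ^+ 2 by rewrite exprn_even_gt0.
  (* For exponent 2 the left side is nonpositive. For larger exponents one factor of absolute value
     [|al| < d] can be split off besides [al ^+ 2]. *)
  case: n {ben al1 aln} => [|n]; first by nra.
  apply: le_lt_trans (ler_norm _) _; rewrite normrN normrM normrX ger0_norm//.
  rewrite -[n.+3]addn2 exprD real_normK ?num_real// mulrA ltr_pM2r//.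
  apply: (le_lt_trans _ ald); rewrite exprS mulrCA ler_piMr// mulr_ile1//.
    exact: exprn_ge0.
  by rewrite exprn_ile1// ltW// (lt_trans ald).
have [Y_lo Y_hi] : - d < - (c * al ^+ n.+2) /\ - (c * al ^+ n.+2) <= al ^+ 2.
  by move: aln; rewrite ler_norml => /andP[]; lra.
have up : d * be ^+ n.+2 - c * al ^+ n.+2 < d.
  (* If [al] is nonzero, [lo] is strict and be^n <= be^2 <= 1 - al^2. If [al = 0], strictness comes
     from [be < 1] instead. *)
  have [al0|al0] := eqVneq al 0; last by have := lo al0; nra.
  by rewrite al0 expr0n mulr0 subr0; nra.
rewrite -subr_gt0 subr_sqr mulr_gt0//; first by lra.
by nra.
Qed.

Theorem lemma9 (R : realType) (D n : nat) (delta : R) (a : 'rV[R]_D)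
    (hD : (2 <= D)%N) (hn : (2 <= n)%N) (hdelta : 0 < delta < 1)
    (ha : unit_sphere R D a) :
  let A : {vspace tensor R D n} := <[tpow n a]>%VS in
  exists Ahat : {vspace tensor R D n},
    [/\ (Ahat <= symtensor R D n)%VS,
        \dim Ahat = 1%N,
        opnorm (orthproj A - orthproj Ahat) = delta &
        exists2 x : 'rV[R]_D,
          strict_local_maximizer (unit_sphere R D) (objective Ahat) x &
          objective Ahat x = delta ^+ 2].
Proof.
move=> A; have [b hb ab0] := orthonormal_complement _ _ a hD.
have /andP[d0 d1] := hdelta.
pose c := Num.sqrt (1 - delta ^+ 2).
have d2 : delta ^+ 2 < 1 by rewrite expr_lt1// ltW.
have cd : c ^+ 2 + delta ^+ 2 = 1.
  by rewrite sqr_sqrtr ?subrK// subr_ge0 ltW.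
have c01 : 0 <= c <= 1.
  by rewrite sqrtr_ge0 -sqrtr1 ler_wsqrtr// gerBl sqr_ge0.
(* Needed because 0^0 = 1: orthogonality of [a] and [b] passes to their tensor powers only for a
   nonzero exponent. *)
have n0 : n != 0%N by rewrite -lt0n (leq_trans _ hn).
have sq1 (z : 'rV[R]_D) : unit_sphere R D z -> \sum_i z 0 i * z 0 i = 1.
  by move=> <-; apply: eq_bigr => i _; rewrite expr2.
have ba0 : \sum_i b 0 i * a 0 i = 0.
  by rewrite -[RHS]ab0; apply: eq_bigr => i _; rewrite mulrC.
have aa : frob (tpow n a) (tpow n a) = 1 by rewrite frob_tpow sq1// expr1n.
have bb : frob (tpow n b) (tpow n b) = 1 by rewrite frob_tpow sq1// expr1n.
have ab : frob (tpow n a) (tpow n b) = 0.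
  by rewrite frob_tpow ab0 expr0n (negPf n0).
have ba : frob (tpow n b) (tpow n a) = 0.
  by rewrite frob_tpow ba0 expr0n (negPf n0).
pose v := delta *: tpow n b - c *: tpow n a.
have vr T : frob T v = delta * frob T (tpow n b) - c * frob T (tpow n a).
  by rewrite linearBr /= !linearZr_LR.
have v1 : frob v v = 1.
  by rewrite vr !linearBl /= !linearZl_LR /= aa bb ab ba -[RHS]cd; ring.
have v0 : v != 0.
  by apply: contra_eq_neq v1 => ->; rewrite linear0l eq_sym oner_neq0.
have objE y : objective <[v]>%VS y = (delta * (\sum_i y 0 i * b 0 i) ^+ n -
    c * (\sum_i y 0 i * a 0 i) ^+ n) ^+ 2.
  by rewrite objective_line// vr !frob_tpow.
have objb : objective <[v]>%VS b = delta ^+ 2.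
  by rewrite objE sq1// ba0 expr1n expr0n (negPf n0) mulr0 subr0 mulr1.
exists <[v]>%VS; split.
- by rewrite -memvE rpredB// rpredZ// tpow_sym.
- by rewrite dim_vline v0.
- exact: opnorm_line_sub.
exists b => //; split=> //.
have dot_cvg (z : 'rV[R]_D) : ((fun y : 'rV[R]_D => \sum_i y 0 i * z 0 i) @ b^'
    --> \sum_i b 0 i * z 0 i)%classic.
  apply: cvg_big => [x|i _]; [exact: add_continuous|]; apply: cvgM; last exact: cvg_cst.
  apply: cvg_within_filter; exact: coord_continuous.
(* Continuity at [b] makes <y,a> small and <y,b> positive, while excluding [y = b] gives <y,b> < 1.
   Bessel's inequality for [a], [b] supplies the remaining hypothesis of [binary_form_bound]. *)
near=> y => y1.
rewrite objb objE; apply: binary_form_bound => //.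
- near: y; apply: (cvgr_norm_lt (\sum_i b 0 i * a 0 i)); first exact: dot_cvg.
  by rewrite ba0 normr0.
- apply/andP; split.
    near: y; apply: (cvgr_gt (\sum_i b 0 i * b 0 i)); first exact: dot_cvg.
    by rewrite sq1.
  by apply: dot_lt1 => //; near: y; exact: nbhs_dnbhs_neq.
- rewrite -y1; apply: bessel2.
Unshelve. all: by end_near.
Qed.
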